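(* For every $n\ge 1$ there is a bijection $\psi:\mathcal{M}^2_{n-1}\to R_n(1212)$ such that $\mathrm{area}(P)=\mathrm{rs}(\psi(P))$ for all $P\in\mathcal{M}^2_{n-1}$.
   Context: A restricted growth function (RGF) of length $n$ is a sequence $w=w_1\dots w_n$ of positive integers with $w_1=1$ and $w_i\le 1+\max\{w_1,\dots,w_{i-1}\}$ for $i\ge 2$; $R_n$ is the set of RGFs of length $n$. The standardization of a word replaces every occurrence of its smallest letter by $1$, of its next smallest letter by $2$, and so on. An RGF $w$ contains an RGF $v$ if some subword (subsequence, not necessarily consecutive) of $w$ standardizes to $v$; otherwise $w$ avoids $v$; $R_n(v)$ is the set of $w\in R_n$ avoiding $v$. For a word $w$ and position $j$, $\mathrm{rs}(w_j)$ is the number of distinct values $w_i$ with $i>j$ and $w_i<w_j$, and $\mathrm{rs}(w)=\sum_j\mathrm{rs}(w_j)$. A Motzkin path of length $m$ is a lattice path from $(0,0)$ to $(m,0)$ staying weakly above the $x$-axis with steps up $(1,1)$, horizontal $(1,0)$ and down $(1,-1)$. A two-colored Motzkin path is a Motzkin path each of whose horizontal steps is colored $a$ or $b$; $\mathcal{M}^2_m$ is the set of two-colored Motzkin paths of length $m$ ($\mathcal{M}^2_0$ contains only the empty path). $\mathrm{area}(P)$ is the area of the region between $P$ and the $x$-axis. *)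

(* Defs.v *)
From mathcomp Require Import all_boot all_order all_algebra.
Import Order.TTheory GRing.Theory Num.Theory.
Set Implicit Arguments.
Unset Strict Implicit.
Unset Printing Implicit Defensive.

(* Words are sequences of natural numbers; letters are indexed from 0, so the
   letter w_(i+1) of the mathematical text is [nth 0 w i]. *)

Definition is_rgf (w : seq nat) : bool :=
  [&& all (fun x => 0 < x) w,
      head 1 w == 1 &
      [forall i : 'I_(size w),
         (0 < i) ==> (nth 0 w i <= 1 + \max_(j < i) nth 0 w j)]].

Definition standardize (u : seq nat) : seq nat :=
  [seq (index x (sort leq (undup u))).+1 | x <- u].

(* The subwords of [w] are the sequences [mask m w], where the bit vector [m]
   selects the positions that are kept. *)
Definition contains (w v : seq nat) : bool :=
  [exists m : (size w).-tuple bool, standardize (mask m w) == v].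

Definition avoids (w v : seq nat) : bool := ~~ contains w v.

Definition rgf_avoiding (n : nat) (v : seq nat) : Type :=
  {w : n.-tuple nat | is_rgf w && avoids w v}.

Definition rs_letter (w : seq nat) (j : nat) : nat :=
  size (undup [seq x <- drop j.+1 w | x < nth 0 w j]).

Definition rs (w : seq nat) : nat := \sum_(j < size w) rs_letter w j.

Inductive color : Set := ColorA | ColorB.

Inductive step : Set := Up | Horizontal of color | Down.

Local Open Scope ring_scope.

Definition rise (s : step) : int :=
  match s with Up => 1 | Horizontal _ => 0 | Down => -1 end.

(* A path starting at (0,0) is given by its steps; it visits the points
   (i, height P i) for 0 <= i <= size P. *)
Definition height (P : seq step) (i : nat) : int :=
  \sum_(s <- take i P) rise s.

Definition is_motzkin (P : seq step) : bool :=
  [forall i : 'I_(size P).+1, 0 <= height P i] && (height P (size P) == 0).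

Definition motzkin2 (m : nat) : Type := {P : m.-tuple step | is_motzkin P}.

(* The region under the i-th step is a (possibly degenerate) trapezoid of
   width 1. *)
Definition area (P : seq step) : rat :=
  \sum_(i < size P) ((height P i + height P i.+1)%:~R / 2).

(* Main.v *)
(** In a 1212-avoiding RGF the values open at a position (seen before it and
    seen again after it) form a stack, and [rs] of the current letter is the
    number of open values below it.  Record, between consecutive letters [c] and
    [x], whether [c] occurs again and whether [x] is new: these two bits are the
    step of the path (again/new is Up, not again/old is Down, again/old and not
    again/new are the two colors of horizontal steps), so the height of the path
    at the i-th point is the size of the stack, that is [rs] of the i-th letter.
    Since the path starts and ends at height 0, its area is the sum of these
    heights. *)
Require Import Defs.
From mathcomp Require Import all_boot all_order all_algebra.
From mathcomp Require Import zify ring.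
Import Order.TTheory GRing.Theory Num.Theory.
Set Implicit Arguments.
Unset Strict Implicit.
Unset Printing Implicit Defensive.

(** * Words avoiding 1212 *)

Definition noncrossing (w : seq nat) : Prop :=
  forall a b, a < b -> ~~ subseq [:: a; b; a; b] w.

(** Letters with the same index in [r] are equal, which identifies the first with the third and the
    second with the fourth; since [r] is sorted, indices 0 and 1 give the order. *)
Lemma standardize1212 (u : seq nat) :
  standardize u = [:: 1; 2; 1; 2] ->
  exists a b, a < b /\ u = [:: a; b; a; b].
Proof.
case: u => [|a [|b [|c [|d [|? ?]]]]] // H.
set u := [:: a; b; c; d] in H *; set r := sort leq (undup u).
have mem_r x : x \in u -> x \in r by rewrite mem_sort mem_undup.
have [ia ib ic id] : [/\ index a r = 0, index b r = 1, index c r = 0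
                       & index d r = 1].
  by move: H; rewrite /standardize -/r /= => -[].
have nth_r x : x \in u -> nth 0 r (index x r) = x.
  by move=> /mem_r xr; rewrite nth_index.
have [au bu cu du] : [/\ a \in u, b \in u, c \in u & d \in u].
  by rewrite !inE !eqxx !orbT.
have ca : c = a by rewrite -[LHS](nth_r c cu) -[RHS](nth_r a au) ic ia.
have db : d = b by rewrite -[LHS](nth_r d du) -[RHS](nth_r b bu) id ib.
exists a, b; split; last by rewrite /u ca db.
have ab : a <= b.
  rewrite -[a in a <= _](nth_r a au) -[b in _ <= b](nth_r b bu).
  apply: (sorted_leq_nth leq_trans leqnn); last by rewrite ia ib.
  - exact: (sort_sorted leq_total).
  - by rewrite inE index_mem mem_r.
  - by rewrite inE index_mem mem_r.
rewrite ltn_neqAle ab andbT; apply/eqP => eab.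
by move: ib; rewrite -eab ia.
Qed.

Lemma standardize_abab (a b : nat) :
  a < b -> standardize [:: a; b; a; b] = [:: 1; 2; 1; 2].
Proof.
move=> ab; have nab : (a == b) = false by lia.
have nba : (b == a) = false by lia.
have ud : undup [:: a; b; a; b] = [:: a; b].
  by rewrite /= !inE !eqxx nab nba orbT.
rewrite /standardize ud sorted_sort; first by rewrite /= !eqxx nab.
  exact: leq_trans.
by rewrite /= ltnW.
Qed.

Lemma avoids1212P (w : seq nat) :
  reflect (noncrossing w) (avoids w [:: 1; 2; 1; 2]).
Proof.
apply: (iffP negP) => [H a b ab|H /existsP [m /eqP /standardize1212]].
  apply/negP => /subseqP [m sm em]; apply: H; apply/existsP.
  by exists (Tuple (introT eqP sm)); rewrite /= -em standardize_abab.
move=> [a [b [ab em]]]; move/negP: (H a b ab); apply.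
by rewrite -em mask_subseq.
Qed.

Lemma noncrossing_subseq (u w : seq nat) :
  subseq u w -> noncrossing w -> noncrossing u.
Proof.
move=> uw H a b ab; apply/negP => /subseq_trans /(_ uw).
exact/negP/H.
Qed.

(** A word without equal neighbours can use only one of two adjacent copies of [x]. *)
Lemma subseq_dup (x : nat) (p q v : seq nat) :
  sorted (fun y z => y != z) v ->
  subseq v (p ++ x :: x :: q) -> subseq v (p ++ x :: q).
Proof.
elim: p v => [|y p IHp] [|z v] //= vs; last first.
  by case: eqP => _; apply: IHp => //; apply: path_sorted vs.
have [zx|zx] := eqVneq z x; last by rewrite (negPf zx).
case: v vs => [|z' v] /=; first by rewrite sub0seq.
by rewrite zx eq_sym; case: eqP.
Qed.

Lemma noncrossing_dup (x : nat) (p q : seq nat) :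
  noncrossing (p ++ x :: q) -> noncrossing (p ++ x :: x :: q).
Proof.
move=> H a b ab; apply: contra (H a b ab); apply: subseq_dup.
by rewrite /= !neq_ltn ab orbT.
Qed.

(** Each letter of a crossing occurs twice in it, so a letter occurring once in the whole word takes
    no part. *)
Lemma noncrossing_once (c : nat) (p q : seq nat) :
  c \notin p -> c \notin q ->
  noncrossing (p ++ q) -> noncrossing (p ++ c :: q).
Proof.
move=> cp cq H a b ab; apply/negP => sub.
have cnt := leq_count_subseq (pred1 c) sub.
rewrite count_cat /= eqxx (count_memPn cp) (count_memPn cq) in cnt.
have ac : a != c by apply/eqP => ac; move: cnt; rewrite ac eqxx; lia.
have bc : b != c by apply/eqP => bc; move: cnt; rewrite bc eqxx; lia.
move/negP: (H a b ab); apply.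
have -> : p ++ q = filter (predC1 c) (p ++ c :: q).
  rewrite filter_cat /= eqxx /= !(all_filterP _) //; apply/allP => x /=.
    by apply: contraTneq => ->.
  by apply: contraTneq => ->.
by rewrite subseq_filter sub /= ac bc.
Qed.

(** * Restricted growth *)

(** Restricted growth of a suffix, with [m] the maximum of the letters before it. *)
Fixpoint rgf_from (m : nat) (t : seq nat) : bool :=
  if t is x :: t' then [&& 0 < x, x <= m.+1 & rgf_from (maxn m x) t'] else true.

Lemma rgf_fromP (m : nat) (t : seq nat) :
  reflect (all (fun x => 0 < x) t /\
           forall i, i < size t ->
             nth 0 t i <= 1 + maxn m (\max_(j < i) nth 0 t j))
          (rgf_from m t).
Proof.
elim: t m => [|x t IHt] m /=; first by apply: ReflectT.
have maxE i : maxn m (\max_(j < i.+1) nth 0 (x :: t) j)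
            = maxn (maxn m x) (\max_(j < i) nth 0 t j).
  by rewrite big_ord_recl maxnA.
apply: (iffP and3P) => [[x0 xm /IHt [t0 H]]|[/andP [x0 t0] H]].
  split=> [|[|i] it]; first by rewrite x0.
    by rewrite big_ord0 maxn0.
  by rewrite maxE; apply: H.
split=> //; first by have := H 0 isT; rewrite big_ord0 maxn0.
by apply/IHt; split=> // i it; have := H i.+1 it; rewrite maxE.
Qed.

Lemma is_rgf_cons (c : nat) (t : seq nat) :
  is_rgf (c :: t) = (c == 1) && rgf_from 1 t.
Proof.
rewrite /is_rgf /=; case: eqP => [->|] /=; last by rewrite andbF.
have maxE i : \max_(j < i.+1) nth 0 (1 :: t) j
            = maxn 1 (\max_(j < i) nth 0 t j) by rewrite big_ord_recl.
apply/andP/rgf_fromP => -[t0 H]; split=> //.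
  move=> i it; have := forallP H (Ordinal (it : i.+1 < (size t).+1)).
  by rewrite /= maxE.
by apply/forallP => -[[|i] it] //=; rewrite maxE; apply: H.
Qed.

(** * Words and paths *)

(* The suffix [t] may follow the current letter [c] when [m] is the maximum so
   far and [s] is the stack of the other values that are still open.  Since the
   values of [s] first occur in increasing order, [rev s ++ c :: t] contains
   every crossing in which [t] is involved. *)
Record admissible (s : seq nat) (c m : nat) (t : seq nat) : Prop := {
  adm_path : path gtn c s;
  adm_max : c <= m;
  adm_rgf : rgf_from m t;
  adm_old : forall y, y \in t -> y <= m -> y \in c :: s;
  adm_open : {subset s <= t};
  adm_noncrossing : noncrossing (rev s ++ c :: t) }.

(** An old letter after [c] must be [c] itself if [c] occurs again, and the top of the stack
    otherwise, so the step determines the next letter. The default in [head 0 s] is reached only by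
    paths that go below the axis. *)
Fixpoint decode (s : seq nat) (c m : nat) (P : seq step) : seq nat :=
  match P with
  | [::] => [::]
  | Up :: P' => m.+1 :: decode (c :: s) m.+1 m.+1 P'
  | Horizontal ColorA :: P' => c :: decode s c m P'
  | Horizontal ColorB :: P' => m.+1 :: decode s m.+1 m.+1 P'
  | Down :: P' => head 0 s :: decode (behead s) (head 0 s) m P'
  end.

Fixpoint encode (c : nat) (t : seq nat) : seq step :=
  if t is x :: t' then
    (if x < c then Down else if x == c then Horizontal ColorA
     else if c \in t' then Up else Horizontal ColorB) :: encode x t'
  else [::].

Fixpoint motzkin_from (h : nat) (P : seq step) : bool :=
  match P with
  | [::] => h == 0
  | Up :: P' => motzkin_from h.+1 P'
  | Horizontal _ :: P' => motzkin_from h P'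
  | Down :: P' => (0 < h) && motzkin_from h.-1 P'
  end.

(** Both endpoints of the path are counted, matching one letter more than there are steps. *)
Fixpoint height_sum (h : nat) (P : seq step) : nat :=
  h + match P with
      | [::] => 0
      | Up :: P' => height_sum h.+1 P'
      | Horizontal _ :: P' => height_sum h P'
      | Down :: P' => height_sum h.-1 P'
      end.

Lemma size_decode s c m P : size (decode s c m P) = size P.
Proof. by elim: P s c m => [|[|[]|] P IHP] s c m //=; rewrite IHP. Qed.

Lemma size_encode c t : size (encode c t) = size t.
Proof. by elim: t c => [|x t IHt] c //=; rewrite IHt. Qed.

Lemma path_gtn_mem (c : nat) (s : seq nat) (y : nat) :
  path gtn c s -> y \in s -> y < c.
Proof.
move=> cs; have gtr : transitive gtn by move=> ? ? ? /=; lia.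
by move/allP: (order_path_min gtr cs) => /(_ y).
Qed.

Lemma path_gtn_notin (c : nat) (s : seq nat) : path gtn c s -> c \notin s.
Proof. by move=> cs; apply/negP => /(path_gtn_mem cs); rewrite ltnn. Qed.

(** * From paths to words *)

Lemma admissible_nilI (c m : nat) : c <= m -> admissible [::] c m [::].
Proof. by move=> cm; split=> // a b ab; apply/negP => /size_subseq. Qed.

(** Induction on the path, comparing [rev s ++ c :: t] with the same word for the shorter path: [Up]
    leaves it unchanged, [ColorA] doubles [c], [ColorB] inserts a [c] that occurs only once, and
    [Down] doubles the top of the stack and inserts such a [c] between the copies. None of these
    creates a crossing. *)
Lemma decodeP s c m P :
  path gtn c s -> 0 < c -> all (leq 1) s -> c <= m -> motzkin_from (size s) P ->
  admissible s c m (decode s c m P) /\ encode c (decode s c m P) = P.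
Proof.
elim: P s c m => [|[|[]|] P IHP] s c m cs c0 s0 cm /=.
- by move/eqP/size0nil ->; split=> //; apply: admissible_nilI.
- move=> HP; have cs' : path gtn m.+1 (c :: s) by rewrite /= cs andbT.
  have [] := IHP (c :: s) m.+1 m.+1 cs' isT _ (leqnn _) HP; first by rewrite /= c0.
  set t := decode _ _ _ _ => -[_ _ Hr Ho Hs Hn] ->.
  have ct : c \in t by apply: Hs; rewrite inE eqxx.
  rewrite ct ltnNge leqW //= gtn_eqF //; split=> //; split=> //.
  + by rewrite /= leqnn (maxn_idPr (leqnSn m)).
  + move=> y; rewrite inE => /orP [/eqP -> | yt ym]; first by rewrite ltnn.
    by have := Ho y yt (leqW ym); rewrite inE; case: eqP => // yE;
       move: ym; rewrite yE ltnn.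
  + by move=> y ys; rewrite inE Hs ?orbT // inE ys orbT.
  + by move: Hn; rewrite rev_cons cat_rcons.
- move=> HP; have [] := IHP s c m cs c0 s0 cm HP.
  set t := decode _ _ _ _ => -[_ _ Hr Ho Hs Hn] ->.
  rewrite ltnn eqxx; split=> //; split=> //.
  + by rewrite /= c0 (leqW cm) (maxn_idPl cm).
  + by move=> y; rewrite inE => /orP [/eqP -> _|]; [rewrite inE eqxx|apply: Ho].
  + by move=> y ys; rewrite inE Hs ?orbT.
  + exact: noncrossing_dup.
- move=> HP.
  have cs' : path gtn m.+1 s.
    by case: (s) cs => //= y s' /andP [yc ->]; rewrite andbT; lia.
  have [] := IHP s m.+1 m.+1 cs' isT s0 (leqnn _) HP.
  set t := decode _ _ _ _ => -[_ _ Hr Ho Hs Hn] ->.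
  (* If [c] recurred, being old it would have to be [m.+1] or lie on [s]. *)
  have ct : c \notin t.
    apply/negP => ct; have := Ho c ct (leqW cm).
    by rewrite inE (negPf (path_gtn_notin cs)) orbF ltn_eqF.
  rewrite (negPf ct) ltnNge leqW //= gtn_eqF //; split=> //; split=> //.
  + by rewrite /= leqnn (maxn_idPr (leqnSn m)).
  + move=> y; rewrite inE => /orP [/eqP -> | yt ym]; first by rewrite ltnn.
    have := Ho y yt (leqW ym); rewrite !inE ltn_eqF //= => ->; exact: orbT.
  + by move=> y ys; rewrite inE Hs ?orbT.
  + apply: noncrossing_once => //; first by rewrite mem_rev path_gtn_notin.
    by rewrite inE negb_or ltn_eqF.
- case: s cs s0 => //= x s /andP [xc xs] /andP [x0 s0] HP.
  have xm : x <= m by lia.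
  have [] := IHP s x m xs x0 s0 xm HP.
  set t := decode _ _ _ _ => -[_ _ Hr Ho Hs Hn] ->.
  have cxs : c \notin x :: s by apply: path_gtn_notin; rewrite /= xc.
  have ct : c \notin t by apply: contra cxs => ct; apply: Ho.
  rewrite xc; split=> //; split=> //.
  + by rewrite /= xc.
  + by rewrite /= x0 (leqW xm) (maxn_idPl xm).
  + move=> y; rewrite inE => /orP [/eqP -> _|yt ym].
      by rewrite !inE eqxx orbT.
    by rewrite inE Ho ?orbT.
  + move=> y; rewrite !inE => /orP [->//|/Hs ->]; exact: orbT.
  + have [cx cns] : c != x /\ c \notin s by apply/andP; rewrite -negb_or -in_cons.
    apply: noncrossing_once; first by rewrite mem_rev.
      by rewrite inE negb_or cx.
    by rewrite rev_cons cat_rcons; apply: noncrossing_dup.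
Qed.

(** * From words to paths *)

Variant admissible_cons_spec (s : seq nat) (c m x : nat) (t : seq nat) : Prop :=
  | AdmUp of x = m.+1 & c \in t & admissible (c :: s) x x t
  | AdmA of x = c & admissible s c m t
  | AdmB of x = m.+1 & c \notin t & admissible s x x t
  | AdmDown s' of s = x :: s' & x < c & admissible s' x m t.

(** A new letter can only be [m.+1], and an old one is [c] or on the stack; avoidance then forces it
    to be the top of the stack, with [c] closed. *)
Lemma admissible_consP s c m x t :
  admissible s c m (x :: t) -> admissible_cons_spec s c m x t.
Proof.
move=> [cs cm /= /and3P [x0 xm Hr] Ho Hs Hn].
have [xE|xNE] := eqVneq x m.+1.
  have sm y : y \in s -> y <= m by move/(path_gtn_mem cs)/ltnW/leq_trans; apply.
  have st : {subset s <= t}.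
    move=> y ys; have := Hs y ys; rewrite inE => /orP [/eqP yx|//].
    by have := sm y ys; rewrite yx xE ltnn.
  have old y : y \in t -> y <= x -> y != x -> y \in c :: s.
    move=> yt yx yNx; apply: Ho; first by rewrite inE yt orbT.
    by move: yx yNx; rewrite xE; lia.
  move: Hr; rewrite xE (maxn_idPr (leqnSn m)) -xE => Hr.
  have [ct|ct] := boolP (c \in t).
    apply: AdmUp => //; split=> //.
    + by rewrite /= cs xE /= ltnS cm.
    + by move=> y yt yx; rewrite inE; have [//|/old->//] := eqVneq y x.
    + by move=> y; rewrite inE => /orP [/eqP -> //|/st].
    + by rewrite rev_cons cat_rcons.
  apply: AdmB => //; split=> //.
  + by case: (s) cs => //= y s' /andP [yc ->]; rewrite andbT xE; lia.
  + move=> y yt yx; rewrite inE; have [//|/old] := eqVneq y x.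
    move=> /(_ yt yx); rewrite inE => /orP [/eqP yc|//].
    by move: ct; rewrite -yc yt.
  + apply: noncrossing_subseq Hn; apply: cat_subseq => //.
    exact: subseq_cons.
have {}xm : x <= m by lia.
rewrite (maxn_idPl xm) in Hr.
have old y : y \in t -> y <= m -> y \in c :: s.
  by move=> yt; apply: Ho; rewrite inE yt orbT.
have [xc|xc] := eqVneq x c.
  apply: AdmA => //; split=> //.
    move=> y ys; have := Hs y ys; rewrite inE => /orP [/eqP yx|//].
    by have := path_gtn_notin cs; rewrite -xc -yx ys.
  apply: noncrossing_subseq Hn; apply: cat_subseq => //.
  by rewrite xc subseq_cons.
have := Ho x; rewrite !inE eqxx (negPf xc) /= => /(_ isT xm) xs.
have xltc := path_gtn_mem cs xs.
have sub1 y z q : subseq [:: y] (z ++ y :: q).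
  by rewrite sub1seq mem_cat inE eqxx orbT.
case: s cs Ho Hs Hn old xs => // y s cs Ho Hs Hn old; rewrite inE.
(* Below the top [y], which is still to recur, [x] would give the crossing [x y x y]. *)
have [xy _|xy xs] := eqVneq x y; last first.
  have xy' : x < y by apply: path_gtn_mem xs; case/andP: cs.
  have : subseq ([:: x] ++ [:: y; x; y]) (rev s ++ y :: c :: x :: t).
    apply: cat_subseq; first by rewrite sub1seq mem_rev.
    have yc : (y == c) = false by case/andP: cs; rewrite /=; lia.
    have yt : y \in t.
      by have := Hs y (mem_head _ _); rewrite inE eq_sym (negPf xy).
    by rewrite /= eqxx (negPf xc) eqxx sub1seq.
  by move: Hn; rewrite rev_cons cat_rcons => /(_ _ _ xy') /negP.
subst y; case/andP: cs => _ xs.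
(* Another [c] would complete the crossing [x c x c]. *)
have ct : c \notin t.
  apply/negP => ct; have /negP := Hn _ _ xltc; apply.
  rewrite rev_cons cat_rcons.
  have -> : [:: x; c; x; c] = [::] ++ [:: x; c; x; c] by [].
  apply: cat_subseq; first exact: sub0seq.
  by rewrite /= !eqxx sub1seq.
apply: (@AdmDown _ _ _ _ _ s) => //; split=> //.
- move=> y yt ym; have := old y yt ym; rewrite inE => /orP [/eqP yc|//].
  by move: ct; rewrite -yc yt.
- move=> y ys; have := Hs y; rewrite !inE ys orbT => /(_ isT) /orP [/eqP yx|//].
  by have := path_gtn_mem xs ys; rewrite yx ltnn.
- apply: noncrossing_subseq Hn; rewrite rev_cons cat_rcons.
  by apply: cat_subseq => //; apply: (suffix_subseq [:: x; c]).
Qed.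

Lemma admissible_nilE s c m : admissible s c m [::] -> s = [::].
Proof. by case=> _ _ _ _ Hs _; case: s Hs => // y s /(_ y (mem_head _ _)). Qed.

Lemma encodeP s c m t :
  admissible s c m t ->
  motzkin_from (size s) (encode c t) /\ decode s c m (encode c t) = t.
Proof.
elim: t s c m => [|x t IHt] s c m Ht /=; first by rewrite (admissible_nilE Ht).
have cm := adm_max Ht.
case/admissible_consP: Ht => [xE ct Ht|xE Ht|xE ct Ht|s' -> xc Ht].
- rewrite ct xE ltnNge leqW //= gtn_eqF //.
  by rewrite xE in Ht; have [/= -> ->] := IHt _ _ _ Ht.
- by rewrite xE ltnn eqxx; have [-> ->] := IHt _ _ _ Ht.
- rewrite (negPf ct) xE ltnNge leqW //= gtn_eqF //.
  by rewrite xE in Ht; have [/= -> ->] := IHt _ _ _ Ht.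
- by rewrite xc /=; have [-> ->] := IHt _ _ _ Ht.
Qed.

(** * The statistic [rs] as a sum of heights *)

Lemma rs_cons c t :
  rs (c :: t) = size (undup [seq x <- t | x < c]) + rs t.
Proof. by rewrite /rs big_ord_recl /= /rs_letter /= drop0. Qed.

(** Later letters below [c] are old, hence on the stack; conversely every value on the stack is
    below [c] and recurs. *)
Lemma size_admissible s c m t :
  admissible s c m t -> size (undup [seq x <- t | x < c]) = size s.
Proof.
case=> cs cm _ Ho Hs _; apply/perm_size/uniq_perm; first exact: undup_uniq.
  have gtr : transitive gtn by move=> ? ? ? /=; lia.
  by apply: (sorted_uniq gtr ltnn); apply: path_sorted cs.
move=> y; rewrite mem_undup mem_filter; apply/andP/idP => [[yc yt]|ys].
  by have := Ho y yt (leq_trans (ltnW yc) cm); rewrite inE ltn_eqF.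
by split; [apply: path_gtn_mem ys|apply: Hs].
Qed.

Lemma rs_encode s c m t :
  admissible s c m t -> rs (c :: t) = height_sum (size s) (encode c t).
Proof.
elim: t s c m => [|x t IHt] s c m Ht; rewrite rs_cons (size_admissible Ht).
  by rewrite /rs big_ord0.
rewrite /=; congr (_ + _); have cm := adm_max Ht.
case/admissible_consP: Ht => [xE ct Ht|xE Ht|xE ct Ht|s' -> xc Ht].
- by rewrite ct (IHt _ _ _ Ht) xE ltnNge leqW //= gtn_eqF.
- by rewrite xE ltnn eqxx; apply: IHt Ht.
- by rewrite (negPf ct) (IHt _ _ _ Ht) xE ltnNge leqW //= gtn_eqF.
- by rewrite xc /=; apply: IHt Ht.
Qed.

(** The coding starts after the letter 1 with an empty stack. The size condition excludes the empty
    word, which [is_rgf] accepts. *)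
Lemma admissible_initP w :
  reflect (exists2 t, w = 1 :: t & admissible [::] 1 1 t)
    [&& 0 < size w, is_rgf w & avoids w [:: 1; 2; 1; 2]].
Proof.
apply: (iffP idP) => [|[t -> []]]; last first.
  by move=> _ _ Hr _ _ /avoids1212P Hn; rewrite is_rgf_cons Hr.
case: w => // c t /= /andP []; rewrite is_rgf_cons => /andP [/eqP -> Hr].
move/avoids1212P => Hn; exists t => //; split=> // y yt y1.
case/rgf_fromP: Hr => /allP /(_ y yt) y0 _.
by rewrite inE; lia.
Qed.

(** * Area *)

Local Open Scope ring_scope.

Lemma height_cons x P i : height (x :: P) i.+1 = rise x + height P i.
Proof. by rewrite /height /= big_cons. Qed.

Lemma height0 P : height P 0 = 0.
Proof. by rewrite /height take0 big_nil. Qed.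

(** The integer heights are shifted by the starting height [h] so that the induction can pass to the
    rest of the path. *)
Lemma motzkin_fromE h P :
  motzkin_from h P =
  [forall i : 'I_(size P).+1, 0 <= h%:Z + height P i] &&
  (h%:Z + height P (size P) == 0).
Proof.
elim: P h => [|x P IHP] h /=.
  rewrite height0 addr0 [X in _ = _ && X]/=; case: forallP => //= -[] [[|i] hi] //.
  by rewrite height0 addr0.
(* One argument serves every step that leads to a natural height [k]; only [Down] from height 0
   escapes it. *)
have forallE k : k%:Z = h%:Z + rise x ->
    motzkin_from k P =
    [forall i : 'I_(size P).+2, 0 <= h%:Z + height (x :: P) i] &&
    (h%:Z + height (x :: P) (size P).+1 == 0).
  move=> kE; rewrite IHP height_cons addrA -kE; congr (_ && _).
  apply/forallP/forallP => H.
    move=> [[|i] hi] /=; first by rewrite height0 addr0.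
    rewrite height_cons addrA -kE.
    exact: (H (Ordinal (hi : (i < (size P).+1)%N))).
  by move=> i; have := H (lift ord0 i); rewrite height_cons addrA -kE.
case: x forallE => [|x|] /= forallE.
- by apply: forallE; lia.
- by apply: forallE; lia.
case: h forallE => [|h] forallE /=; last by apply: forallE; lia.
apply/esym/negbTE; rewrite negb_and negb_forall; apply/orP; left.
(* This index is 1, the point where the path reaches height -1. *)
by apply/existsP; exists (lift ord0 ord0); rewrite /= height_cons height0.
Qed.

Lemma is_motzkinE P : is_motzkin P = motzkin_from 0 P.
Proof.
rewrite motzkin_fromE /is_motzkin add0r; congr (_ && _).
by apply: eq_forallb => i; rewrite add0r.
Qed.

(* [h / 2] makes up for the left endpoint, whose height is only halved in the
   trapezoid sum; the right endpoint is at height 0. *)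
Lemma area_from (h : nat) P :
  motzkin_from h P ->
  \sum_(i < size P)
     (((h%:Z + height P i) + (h%:Z + height P i.+1))%:~R / 2 : rat) + h%:R / 2
  = (height_sum h P)%:R.
Proof.
elim: P h => [|x P IHP] h /=.
  by move/eqP ->; rewrite big_ord0 mul0r.
(* The first trapezoid is [h / 2 + k / 2]: one half completes the extra [h / 2] to [h], the other is
   the correction that the rest of the path requires. *)
have step k : k%:Z = h%:Z + rise x -> motzkin_from k P ->
    \sum_(i < (size P).+1) (((h%:Z + height (x :: P) i) +
       (h%:Z + height (x :: P) i.+1))%:~R / 2 : rat) + h%:R / 2
    = (h + height_sum k P)%:R.
  move=> kE /IHP HP; rewrite natrD -HP big_ord_recl.
  rewrite height_cons !height0 !addr0 -kE.
  under eq_bigr => i _ do rewrite lift0 !height_cons !(addrA h%:Z) -kE.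
  rewrite !rmorphD /= -!pmulrn; set S := bigop _ _ _.
  by field.
case: x step => [|x|] /= step.
- by apply: step; lia.
- by apply: step; lia.
- by case/andP => h0; apply: step; lia.
Qed.

Lemma area_height_sum P : is_motzkin P -> area P = (height_sum 0 P)%:R.
Proof.
rewrite is_motzkinE => /area_from <-; rewrite mul0r addr0.
by apply: eq_bigr => i _; rewrite !add0r.
Qed.

(** * The bijection *)

Theorem theorem5p7 (n : nat) (hn : (1 <= n)%N) :
  exists psi : motzkin2 n.-1 -> rgf_avoiding n [:: 1; 2; 1; 2]%N,
    bijective psi /\
    forall P : motzkin2 n.-1, area (val P) = (rs (val (psi P)))%:R.
Proof.
case: n hn => // n _ /=.
have decP (P : motzkin2 n) : admissible [::] 1 1 (decode [::] 1 1 (val P)) /\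
    encode 1 (decode [::] 1 1 (val P)) = val P.
  by apply: decodeP => //; rewrite -is_motzkinE (valP P).
(* The initial letter 1 is coded by no step, so [n] steps give [n.+1] letters. *)
have psi_size (P : motzkin2 n) : size (1%N :: decode [::] 1 1 (val P)) == n.+1.
  by rewrite /= size_decode size_tuple.
have psi_ok (P : motzkin2 n) : is_rgf (Tuple (psi_size P)) &&
    avoids (Tuple (psi_size P)) [:: 1; 2; 1; 2]%N.
  have [adm _] := decP P.
  have: exists2 t, 1%N :: decode [::] 1 1 (val P) = 1%N :: t &
      admissible [::] 1 1 t by exists (decode [::] 1 1 (val P)).
  by move/admissible_initP.
have encP (w : rgf_avoiding n.+1 [:: 1; 2; 1; 2]%N) :
    exists2 t, val w = 1%N :: t :> seq nat & admissible [::] 1 1 t.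
  by apply/admissible_initP; rewrite size_tuple (valP w).
have phi_size (w : rgf_avoiding n.+1 [:: 1; 2; 1; 2]%N) :
    size (encode 1 (behead (val w))) == n.
  by rewrite size_encode size_behead size_tuple.
have phi_ok (w : rgf_avoiding n.+1 [:: 1; 2; 1; 2]%N) :
    is_motzkin (Tuple (phi_size w)).
  have [t wE adm] := encP w.
  by rewrite is_motzkinE /= wE; have [] := encodeP adm.
pose psi (P : motzkin2 n) : rgf_avoiding n.+1 [:: 1; 2; 1; 2]%N :=
  exist _ (Tuple (psi_size P)) (psi_ok P).
pose phi (w : rgf_avoiding n.+1 [:: 1; 2; 1; 2]%N) : motzkin2 n :=
  exist _ (Tuple (phi_size w)) (phi_ok w).
exists psi; split.
  (* The two uses of [val_inj] strip the subtype and then the tuple, leaving equations between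
     sequences. *)
  exists phi => [P|w]; do 2 apply: val_inj; rewrite /=.
    by have [] := decP P.
  have [t wE adm] := encP w.
  by rewrite wE /=; have [_ ->] := encodeP adm.
move=> P; have [adm PE] := decP P.
by rewrite /= (rs_encode adm) PE area_height_sum // (valP P).
Qed.
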